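(* Let $W\in\mathscr K^2$ and let $\phi$ be an integer-valued monotone $\sigma$-continuous valuation defined on the closed convex subsets of $W$. Then its support $$F=\{x\in W:\phi(\{x\})\ge 1\}$$ is polyconvex with closed convex components, i.e. $F$ is a union of finitely many closed convex sets.
   Context: $\mathscr K^2$ is the family of all compact convex subsets of $\mathbb R^2$, including the empty set. A valuation on the closed convex subsets of $W$ (including $\emptyset$) is a map $\phi$ with $\phi(\emptyset)=0$ and $\phi(K\cup L)+\phi(K\cap L)=\phi(K)+\phi(L)$ for all closed convex $K,L\subset W$ such that $K\cup L$ is convex. It is monotone if $\phi(K)\le\phi(L)$ whenever $K\subset L$. It is $\sigma$-continuous if $\phi(K_n)\to\phi(K)$ for every sequence $(K_n)$ of closed convex subsets of $W$ with $K_n\downarrow K$ (decreasing with intersection $K$). A set is polyconvex if it is a finite union of (not necessarily disjoint) convex sets, called its convex components; the empty set is polyconvex. *)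

(* Defs.v *)
From HB Require Import structures.
From mathcomp Require Import all_boot all_order all_algebra.
From mathcomp Require Import all_classical all_reals all_analysis.

Set Implicit Arguments.
Unset Strict Implicit.
Unset Printing Implicit Defensive.

Import Order.TTheory GRing.Theory Num.Theory.
Import numFieldNormedType.Exports.

Local Open Scope classical_set_scope.
Local Open Scope ring_scope.

Section definitions.
Variable R : realType.

(* The library norm on 'rV[R]_2 is the sup norm; it induces the usual topology
   of the plane, and only the topology is used below. *)
Definition convex (K : set 'rV[R]_2) : Prop := @convex_set R 'rV[R]_2 K.

Definition compact_convex (K : set 'rV[R]_2) : Prop := compact K /\ convex K.

(* A function on the closed convex subsets of W is represented by a total
   function on sets of which only the values on closed_convex_in W matter. *)
Definition closed_convex_in (W K : set 'rV[R]_2) : Prop :=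
  [/\ closed K, convex K & K `<=` W].

Definition valuation_on (W : set 'rV[R]_2) (phi : set 'rV[R]_2 -> R) : Prop :=
  phi set0 = 0 /\
  forall K L, closed_convex_in W K -> closed_convex_in W L ->
    convex (K `|` L) ->
    phi (K `|` L) + phi (K `&` L) = phi K + phi L.

Definition integer_valued_on (W : set 'rV[R]_2) (phi : set 'rV[R]_2 -> R) :
    Prop :=
  forall K, closed_convex_in W K -> phi K \is a Num.int.

Definition monotone_on (W : set 'rV[R]_2) (phi : set 'rV[R]_2 -> R) : Prop :=
  forall K L, closed_convex_in W K -> closed_convex_in W L ->
    K `<=` L -> phi K <= phi L.

Definition sigma_continuous_on (W : set 'rV[R]_2) (phi : set 'rV[R]_2 -> R) :
    Prop :=
  forall (K_ : nat -> set 'rV[R]_2) (K : set 'rV[R]_2),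
    (forall n, closed_convex_in W (K_ n)) ->
    (forall n, K_ n.+1 `<=` K_ n) ->
    \bigcap_n K_ n = K ->
    phi (K_ n) @[n --> \oo] --> phi K.

Definition support_on (W : set 'rV[R]_2) (phi : set 'rV[R]_2 -> R) :
    set 'rV[R]_2 :=
  [set x | W x /\ 1 <= phi [set x]].

Definition convex_components (F : set 'rV[R]_2) (n : nat)
    (C : 'I_n -> set 'rV[R]_2) : Prop :=
  (forall i, convex (C i)) /\ F = \bigcup_i C i.

(* With n = 0 this includes the empty set. *)
Definition polyconvex_closed_components (F : set 'rV[R]_2) : Prop :=
  exists (n : nat) (C : 'I_n -> set 'rV[R]_2),
    convex_components F C /\ forall i, closed (C i).

End definitions.

(* Main.v *)
Require Import Defs.
From mathcomp Require Import all_boot all_order all_algebra.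
From mathcomp Require Import all_classical all_reals all_analysis.
From mathcomp Require Import zify ring lra.

Set Implicit Arguments.
Unset Strict Implicit.
Unset Printing Implicit Defensive.

Import Order.TTheory GRing.Theory Num.Theory.
Import numFieldNormedType.Exports.

Local Open Scope classical_set_scope.
Local Open Scope ring_scope.

(* By compactness it suffices to treat a closed ball B around x with
   phi(B) = phi({x}) = m. Additivity along segments shows that every level set
   of f(y) = phi({y}) is star-shaped at x. Replacing K by its e-neighbourhood
   makes f = m on the e-ball around x, hence all level sets star-shaped with
   respect to that ball. The projective map sending x to infinity turns each
   open half plane bounded by the vertical line through x into an upper half
   plane, in which {f > k} becomes the epigraph of a Lipschitz function g_k
   (k < m). These m graphs can be retraced by m convex polygonal lines: at a
   vertex where the levels p, ..., q-1 coincide, pass from level k to level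
   p + q - 1 - k. A concave turn there would give a short segment of weight
   > q close to a point of weight q. So every finite subset of the support is
   covered by m convex subsets of the support of the fattened valuation, for
   every e, and an ultrafilter turns these covers into m convex sets covering
   the part of the support in that half plane. *)

(** * Finite combinatorics: reversal of blocks of equal values, and convex sequences *)

Lemma count_initial (a : pred nat) m :
  (forall j k, (j <= k)%N -> (k < m)%N -> a k -> a j) ->
  forall j, (j < m)%N -> (j < count a (iota 0 m))%N = a j.
Proof.
elim: m => // m IH am j; rewrite ltnS -[m.+1]addn1 iotaD count_cat /= add0n addn0.
have am' : forall j k, (j <= k)%N -> (k < m)%N -> a k -> a j.
  by move=> ? k ? km; apply: am => //; exact: ltnW.
have [aM|aM] := boolP (a m).
  have -> : count a (iota 0 m) = m.
    rewrite -[RHS](size_iota 0 m); apply/eqP; rewrite -all_count.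
    by apply/allP => k; rewrite mem_iota add0n => /andP[_ /ltnW km]; exact: am aM.
  by move=> jm; rewrite addn1 ltnS jm (am j m).
rewrite addn0 leq_eqVlt => /orP[/eqP->|jm]; last exact: IH.
rewrite (negbTE aM); apply/negbTE; rewrite -leqNgt.
by rewrite -[leqRHS](size_iota 0 m) count_size.
Qed.

(** A monotone sequence is constant on consecutive blocks [p, ..., q - 1], and [t] is the involution
    that reverses each block. It prescribes how the polygonal lines switch levels at a vertex. *)
Lemma block_reversal (R : realType) m (h : nat -> R) :
  (forall j k, (j <= k)%N -> (k < m)%N -> h j <= h k) ->
  exists t : nat -> nat, forall k, (k < m)%N ->
    [/\ (t k < m)%N, t (t k) = k, h (t k) = h k & exists p q,
      [/\ (k + t k).+1 = (p + q)%N,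
        (forall j, (j < m)%N -> (j < p)%N = (h j < h k)) &
        (forall j, (j < m)%N -> (j < q)%N = (h j <= h k))]].
Proof.
move=> hh.
(* The values below [h k] occupy an initial segment of the indices, so counting them gives the
   position where the block of [k] begins; [q] is likewise its end. *)
pose p k := count (fun j => h j < h k) (iota 0 m).
pose q k := count (fun j => h j <= h k) (iota 0 m).
have pP k j : (j < m)%N -> (j < p k)%N = (h j < h k).
  apply: (count_initial (a := fun j => h j < h k)) => i i' ii' im.
  by apply: le_lt_trans; exact: hh.
have qP k j : (j < m)%N -> (j < q k)%N = (h j <= h k).
  apply: (count_initial (a := fun j => h j <= h k)) => i i' ii' im.
  by apply: le_trans; exact: hh.
have qm k : (q k <= m)%N by rewrite -[leqRHS](size_iota 0 m) count_size.
have pk k : (k < m)%N -> (p k <= k)%N.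
  by move=> km; rewrite leqNgt pP// ltxx.
have kq k : (k < m)%N -> (k < q k)%N by move=> km; rewrite qP.
exists (fun k => p k + q k - k.+1)%N => k km.
set k' := (_ - _)%N; have pkk := pk k km; have kqk := kq k km; have qk := qm k.
have k'm : (k' < m)%N by rewrite /k'; lia.
have hk : h k' = h k.
  apply/eqP; rewrite eq_le -qP//; apply/andP; split; first by rewrite /k'; lia.
  by rewrite leNgt -pP// -leqNgt /k'; lia.
split => //.
  by rewrite /p /q hk -/(p k) -/(q k) /k'; lia.
exists (p k), (q k); split; [by rewrite /k'; lia | exact: pP | exact: qP].
Qed.

(** Nondecreasing slopes make the polygonal line through the points [(w i, h i)] convex, so its
    vertices lie above the line carrying any edge. The induction moves away from edge [i], to the
    right in [fwd] and to the left in [bwd]. *)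
Lemma convex_seq_above (R : realType) n (w h s : nat -> R) :
  (forall i, (i < n)%N -> w i < w i.+1) ->
  (forall i, (i < n)%N -> h i.+1 = h i + s i * (w i.+1 - w i)) ->
  (forall i, (i.+1 < n)%N -> s i <= s i.+1) ->
  forall i j, (i < n)%N -> (j <= n)%N -> h i + s i * (w j - w i) <= h j.
Proof.
move=> wi hi si.
have smono i k : (i + k < n)%N -> s i <= s (i + k)%N.
  elim: k => [|k IH]; rewrite ?addn0// addnS => ikn.
  by apply: le_trans (si _ ikn); apply: IH; exact: ltnW.
have fwd i k : (i + k <= n)%N -> h i + s i * (w (i + k)%N - w i) <= h (i + k)%N.
  elim: k => [|k IH]; first by rewrite addn0 subrr mulr0 addr0.
  rewrite addnS => ikn; rewrite hi//.
  have := IH (ltnW ikn); have := smono i k ikn; have := wi _ ikn => w1 s1.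
  have : s i * (w (i + k).+1 - w (i + k)%N) <= s (i + k)%N * (w (i + k).+1 - w (i + k)%N).
    by rewrite ler_wpM2r// subr_ge0 ltW.
  by lra.
have bwd j k : (j + k < n)%N ->
    h (j + k)%N + s (j + k)%N * (w j - w (j + k)%N) <= h j.
  elim: k j => [|k IH] j; first by rewrite addn0 subrr mulr0 addr0.
  rewrite -addSnnS => jkn; have jn : (j < n)%N by lia.
  have := IH _ jkn; have := wi _ jn; have := hi _ jn => -> w1.
  have : s j <= s (j.+1 + k)%N by rewrite addSnnS; apply: smono; lia.
  move=> s1.
  have : s j * (w j.+1 - w j) <= s (j.+1 + k)%N * (w j.+1 - w j).
    by rewrite ler_wpM2r// subr_ge0 ltW.
  by lra.
move=> i j i_n jn; have [ij|ji] := leqP i j.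
  by have := @fwd i (j - i)%N; rewrite subnKC//; exact.
by have := @bwd j (i - j)%N; rewrite subnKC ?(ltnW ji)//; exact.
Qed.

(** * Subdivisions of an interval with prescribed nodes *)

Section Chain.
Variables (R : realType) (r : R -> R -> Prop) (E : seq R) (a b : R).

(** Taking the points of [E] as nodes ensures later that each point to be covered lies over a vertex
    of the polygonal lines. *)
Definition chained c := exists n (w : nat -> R), [/\ w 0%N = a, w n = c,
  (forall i, (i < n)%N -> w i < w i.+1 /\ r (w i) (w i.+1)) &
  forall e, e \in E -> a <= e <= c -> exists2 i, (i <= n)%N & w i = e].

Lemma chained_extend c c' : chained c -> c < c' -> r c c' ->
  (forall e, e \in E -> c < e -> c' <= e) -> chained c'.
Proof.
move=> [n [w [w0 wn wi wE]]] cc' rcc' noE.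
exists n.+1, (fun i => if (i <= n)%N then w i else c'); split => //.
- by rewrite ltnn.
- move=> i; rewrite ltnS => i_n; rewrite i_n; case: ltnP => // ni; first exact: wi.
  by rewrite (_ : i = n) ?wn//; apply/eqP; rewrite eqn_leq i_n.
- move=> e eE /andP[ae]; rewrite le_eqVlt => /orP[/eqP ->|ec'].
    by exists n.+1 => //; rewrite ltnn.
  have [ec|ce] := leP e c.
    have [|i i_n wie] := wE e eE; first by rewrite ae.
    by exists i; rewrite ?i_n// (leq_trans i_n).
  by have := noE e eE ce; rewrite leNgt ec'.
Qed.

Lemma isolate s : exists2 d, 0 < d & forall e, e \in E -> `|e - s| < d -> e = s.
Proof.
elim: (E) => [|e E' [d d0 dP]]; first by exists 1.
have [->|es] := eqVneq e s.
  by exists d => // e'; rewrite inE => /orP[/eqP ->//|]; exact: dP.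
exists (Num.min d `|e - s|); first by rewrite lt_min d0 normr_gt0 subr_eq0.
move=> e'; rewrite inE lt_min => /orP[/eqP ->|e'E]; first by rewrite ltxx andbF.
by case/andP => ? _; exact: dP.
Qed.

(** Continuous induction: the supremum of the reachable [c] is reachable, and could be passed if it
    were below [b]. Steps are kept shorter than the distance given by [isolate], so that none jumps
    over a point of [E]. *)
Lemma chained_all : a <= b -> (forall u, exists2 d, 0 < d &
  forall v, `|v - u| < d -> r u v /\ r v u) -> chained b.
Proof.
move=> ab rloc; pose A : set R := [set c | c <= b /\ chained c].
have Aa : A a.
  split=> //; exists 0%N, (fun=> a); split=> // e _ /andP[ae ea].
  by exists 0%N => //; apply/eqP; rewrite eq_le ae ea.
have bA : has_sup A by split; [exists a | exists b => c []].
have ubA c : A c -> c <= sup A by move=> ?; apply: ub_le_sup => //; exists b => ? [].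
have sb : sup A <= b by apply: ge_sup; [exists a | move=> c []].
have [d1 d10 d1P] := rloc (sup A); have [d2 d20 d2P] := isolate (sup A).
pose d := Num.min d1 d2; have d0 : 0 < d by rewrite lt_min d10.
have [c [cb cc] sc] := sup_adherent d0 bA.
have cs : c <= sup A by exact: ubA.
have As : chained (sup A).
  move: cs; rewrite le_eqVlt => /orP[/eqP <-//|cs].
  have : `|c - sup A| < d by rewrite distrC ger0_norm ?subr_ge0 ?ltW//; lra.
  rewrite lt_min => /andP[cd1 cd2].
  apply: (chained_extend cc cs); first by have [] := d1P _ cd1.
  move=> e eE ce; rewrite leNgt; apply/negP => es.
  have : `|e - sup A| < d2.
    apply: lt_trans cd2; rewrite !(distrC _ (sup A)) !ger0_norm ?subr_ge0 ?ltW//.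
    lra.
  by move=> /(d2P _ eE) ee; move: es; rewrite ee ltxx.
move: sb; rewrite le_eqVlt => /orP[/eqP <-//|sb].
pose c' := Num.min b (sup A + d / 2).
have sc' : sup A < c' by rewrite lt_min sb; lra.
have c'd : c' <= sup A + d / 2 by rewrite ge_min lexx orbT.
have dist e : sup A < e -> e <= c' -> `|e - sup A| < d.
  by move=> h1 h2; rewrite ger0_norm ?subr_ge0 ?ltW//; lra.
have : A c'.
  split; first by rewrite ge_min lexx.
  have := dist c' sc' (lexx _); rewrite lt_min => /andP[cd1 _].
  apply: (chained_extend As sc'); first by have [] := d1P _ cd1.
  move=> e eE se; rewrite leNgt; apply/negP => ec'.
  have := dist e se (ltW ec'); rewrite lt_min => /andP[_ /(d2P _ eE) ee].
  by move: se; rewrite ee ltxx.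
by move=> /ubA; rewrite leNgt sc'.
Qed.

End Chain.

Definition lerp (R : realType) (l : R) (p q : R * R) : R * R :=
  ((1 - l) * p.1 + l * q.1, (1 - l) * p.2 + l * q.2).

Lemma lerp_gt0 (R : realType) (l a b : R) :
  0 <= l <= 1 -> 0 < a -> 0 < b -> 0 < (1 - l) * a + l * b.
Proof.
move=> /andP[l0 l1] a0 b0; have [->|ln1] := eqVneq l 1; first by lra.
have : 0 < (1 - l) * a by rewrite mulr_gt0// subr_gt0 lt_neqAle ln1.
have : 0 <= l * b by rewrite mulr_ge0// ltW.
lra.
Qed.

Lemma lerp_above_line (R : realType) (l x y w a a' b b' : R) : 0 <= l <= 1 ->
  x + y * (a - w) <= a' -> x + y * (b - w) <= b' ->
  x + y * ((1 - l) * a + l * b - w) <= (1 - l) * a' + l * b'.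
Proof.
move=> /andP[l0 l1]; rewrite -subr_ge0 => h1; rewrite -subr_ge0 => h2.
have l1' : 0 <= 1 - l by rewrite subr_ge0.
by have := mulr_ge0 l1' h1; have := mulr_ge0 l0 h2; lra.
Qed.

(** * Valuations on segments of the upper half plane *)

Section Terrain.
(** [S p q] stands for the weight of the segment from [p] to [q], and [f p] for that of the point
    [p]; [m] bounds the point weights and [L] will be the Lipschitz constant of the level graphs. *)
Variables (R : realType) (m : nat) (S : R * R -> R * R -> nat) (L : R).
Local Notation f p := (S p%R p%R).
Hypothesis L_ge0 : 0 <= L.
Hypothesis S_add : forall (p q : R * R) (l : R), 0 < p.2 -> 0 < q.2 -> 0 <= l <= 1 ->
  (S p q + f (lerp l p q) = S p (lerp l p q) + S (lerp l p q) q)%N.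
Hypothesis S_gel : forall p q : R * R, 0 < p.2 -> 0 < q.2 -> (f p <= S p q)%N.
Hypothesis S_ger : forall p q : R * R, 0 < p.2 -> 0 < q.2 -> (f q <= S p q)%N.
Hypothesis S_loc : forall p : R * R, 0 < p.2 -> exists2 e : R, 0 < e &
  forall a b : R * R, `|a.1 - p.1| < e -> `|a.2 - p.2| < e ->
    `|b.1 - p.1| < e -> `|b.2 - p.2| < e -> (S a b <= f p)%N.
Hypothesis f_le : forall p : R * R, 0 < p.2 -> (f p <= m)%N.
Hypothesis f_up : forall u t v t' : R, 0 < t -> L * `|v - u| <= t' - t ->
  (f (u, t) <= f (v, t'))%N.
Hypothesis f_full : forall u, exists2 t : R, 0 < t & (m <= f (u, t))%N.
Hypothesis f_zero : forall u, exists2 t0 : R, 0 < t0 &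
  forall t : R, 0 < t -> t <= t0 -> f (u, t) = 0%N.

Lemma f_vert u t t' : 0 < t -> t <= t' -> (f (u, t) <= f (u, t'))%N.
Proof. by move=> t0 tt'; apply: f_up => //; rewrite subrr normr0 mulr0 subr_ge0. Qed.

(** The threshold is the infimum of the heights of weight above [k]: [f_full] makes this set
    nonempty, [f_zero] keeps it away from 0, and [S_loc], as upper semicontinuity of [f], makes the
    infimum attained. *)
Lemma level_exists k u : exists c : R, (k < m)%N ->
  0 < c /\ forall t : R, 0 < t -> (k < f (u, t))%N = (c <= t).
Proof.
have [km|mk] := ltnP k m; last by exists 0.
pose A : set R := [set t | 0 < t /\ (k < f (u, t))%N].
have [t1 t10 t1m] := f_full u; have [t0 t00 t0P] := f_zero u.
have A0 : A !=set0 by exists t1; split=> //; exact: leq_trans km t1m.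
have lbA : lbound A t0.
  move=> t [t_gt0 kf]; rewrite leNgt; apply/negP => /ltW tt0.
  by move: kf; rewrite t0P.
have hA : has_inf A by split => //; exists t0.
have cge : t0 <= inf A by apply: lb_le_inf.
have c0 : 0 < inf A by exact: lt_le_trans cge.
exists (inf A) => _; split=> // t t_gt0; apply/idP/idP => [kf|ct].
  by apply: ge_inf; [exists t0 | split].
have [e e0 eP] := S_loc (p := (u, inf A)) c0.
have [s [s0 ks] slt] := @inf_adherent _ A e e0 hA.
have cs : inf A <= s by apply: ge_inf; [exists t0|split].
apply: (@leq_trans (f (u, inf A))); last exact: f_vert.
apply: leq_trans ks _; apply: eP => /=; rewrite ?subrr ?normr0//;
  by rewrite ger0_norm ?subr_ge0// ltrBlDl.
Qed.

(** For [r] on the segment, [f p + f q <= S p r + S r q = S p q + f r], while [S p q <= f p] for [q]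
    near [p]. *)
Lemma star_loc p : 0 < p.2 -> exists2 e : R, 0 < e & forall (q : R * R) (l : R), 0 < q.2 ->
  `|q.1 - p.1| < e -> `|q.2 - p.2| < e -> 0 <= l <= 1 ->
  (f q <= f (lerp l p q))%N.
Proof.
move=> p0; have [e e0 eP] := S_loc p0; exists e => // q l q0 q1 q2 l01.
have r0 : 0 < (lerp l p q).2 by exact: lerp_gt0.
have := S_add p0 q0 l01; have := S_gel p0 r0; have := S_ger r0 q0.
have : (S p q <= f p)%N by apply: eP; rewrite ?subrr ?normr0.
move: (S p q) (S p _) (S _ q) (f p) (f q) (f _).
by clear; lia.
Qed.

(** * The level graphs and their retracing by convex polygonal lines *)

Section Levels.
Variable g : nat -> R -> R.
Hypothesis gP : forall k u, (k < m)%N ->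
  0 < g k u /\ forall t : R, 0 < t -> (k < f (u, t))%N = (g k u <= t).

Let g_gt0 k u : (k < m)%N -> 0 < g k u. Proof. by move=> km; have [] := gP u km. Qed.
Let gE k u t : (k < m)%N -> 0 < t -> (k < f (u, t))%N = (g k u <= t).
Proof. by move=> km; have [_] := gP u km; apply. Qed.

Lemma level_homo j k u : (j <= k)%N -> (k < m)%N -> g j u <= g k u.
Proof.
move=> jk km; have jm := leq_ltn_trans jk km.
by rewrite -gE ?g_gt0// (leq_ltn_trans jk)// gE ?g_gt0.
Qed.

Lemma level_lip k u v : (k < m)%N -> g k v <= g k u + L * `|v - u|.
Proof.
move=> km; have gu := g_gt0 u km.
have Lv : 0 <= L * `|v - u| by rewrite mulr_ge0.
rewrite -gE//; last by lra.
by apply: (@leq_trans (f (u, g k u))); [rewrite gE | apply: f_up => //; lra].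
Qed.

Definition link u v := forall k l, (k < m)%N -> 0 <= l <= 1 ->
  (k < f (lerp l (u, g k u) (v, g k v)))%N.

Lemma lerpC l (p q : R * R) : lerp l p q = lerp (1 - l) q p.
Proof. by rewrite /lerp; congr pair; ring. Qed.

(** Each point of a level graph sees the nearby points of that graph by [star_loc]; the induction on
    [n] takes the least radius over the levels. *)
Lemma link_loc u : exists2 d : R, 0 < d & forall v, `|v - u| < d ->
  link u v /\ link v u.
Proof.
suff [d d0 dP] : exists2 d : R, 0 < d & forall v, `|v - u| < d -> link u v.
  exists d => // v vd; split; first exact: dP.
  move=> k l km l01; rewrite lerpC; apply: dP => //.
  by case/andP: l01 => ? ?; apply/andP; split; lra.
have H n : (n <= m)%N -> exists2 d : R, 0 < d & forall v, `|v - u| < d ->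
    forall k l, (k < n)%N -> 0 <= l <= 1 ->
    (k < f (lerp l (u, g k u) (v, g k v)))%N.
  elim: n => [_|n IH nm]; first by exists 1.
  have [d d0 dP] := IH (ltnW nm).
  have [e e0 eP] := star_loc (p := (u, g n u)) (g_gt0 u nm).
  have L1 : 0 < 1 + L by rewrite ltr_wpDr.
  have e1 : 0 < e / (1 + L) by exact: divr_gt0.
  (* Dividing by [1 + L] makes both the horizontal offset and the Lipschitz variation of the graph
     smaller than [e]. *)
  exists (Num.min d (e / (1 + L))); first by rewrite lt_min d0.
  move=> v; rewrite lt_min => /andP[vd ve] k l; rewrite ltnS leq_eqVlt.
  case/orP => [/eqP-> l01|]; last exact: dP.
  have vgt := g_gt0 v nm.
  have ve2 : `|v - u| * (1 + L) < e by rewrite -ltr_pdivlMr.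
  apply: (@leq_trans (f (v, g n v))); first by rewrite gE.
  have nv := normr_ge0 (v - u).
  have nL : 0 <= `|v - u| * L by rewrite mulr_ge0.
  apply: eP => //=; first lra.
  have := level_lip u v nm; have := level_lip v u nm.
  rewrite (distrC u v) => h1 h2; rewrite ltr_norml; apply/andP; split; lra.
have [d d0 dP] := H m (leqnn m).
by exists d => // v vd k l km; apply: dP.
Qed.

Definition slope k u v := (g k v - g k u) / (v - u).

Lemma link_chord k u v w : u < v -> link u v -> (k < m)%N -> u <= w <= v ->
  (k < f (w, g k u + slope k u v * (w - u)))%N.
Proof.
move=> uv luv km /andP[uw wv].
have := luv k ((w - u) / (v - u)) km; have vu : v - u != 0 by lra.
rewrite (_ : lerp _ _ _ = (w, g k u + slope k u v * (w - u))).
  apply; rewrite divr_ge0 ?subr_ge0 ?(ltW uv)//=.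
  by rewrite ler_pdivrMr ?subr_gt0// mul1r lerD2r.
by rewrite /lerp /slope /=; congr pair; field.
Qed.

Lemma chord_gt0 k u v w : u < v -> (k < m)%N -> u <= w <= v ->
  0 < g k u + slope k u v * (w - u).
Proof.
move=> uv km /andP[uw wv].
have vu : v - u != 0 by lra.
rewrite (_ : _ + _ = (1 - (w - u) / (v - u)) * g k u + (w - u) / (v - u) * g k v).
  apply: lerp_gt0; rewrite ?g_gt0//.
  rewrite divr_ge0 ?subr_ge0 ?(ltW uv)//=.
  by rewrite ler_pdivrMr ?subr_gt0// mul1r lerD2r.
by rewrite /slope; field.
Qed.

(** The incoming edge follows [k], the outgoing one its mirror image [k'] in the block
    [p, ..., q - 1] of levels that meet over [u1]. Only the sum [k + k'] enters the count of
    weights, which is why reversing the block excludes concave turns. *)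
Lemma turn u0 u1 u2 k k' p q : u0 < u1 -> u1 < u2 -> link u0 u1 -> link u1 u2 ->
  (k < m)%N -> (k' < m)%N -> g k' u1 = g k u1 -> (k + k').+1 = (p + q)%N ->
  (forall j, (j < m)%N -> (j < p)%N = (g j u1 < g k u1)) ->
  (forall j, (j < m)%N -> (j < q)%N = (g j u1 <= g k u1)) ->
  slope k u0 u1 <= slope k' u1 u2.
Proof.
move=> u01 u12 l01 l12 km k'm gkk' kpq pP qP; rewrite leNgt; apply/negP => s21.
set c := g k u1 in gkk' pP qP *.
set s1 := slope k u0 u1 in s21 *; set s2 := slope k' u1 u2 in s21 *.
have c0 : 0 < c by exact: g_gt0.
have [e e0 eP] := S_loc (p := (u1, c)) c0.
pose D := Num.min e (Num.min (u1 - u0) (u2 - u1)).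
have D0 : 0 < D by rewrite !lt_min e0 !subr_gt0 u01.
have [De D01 D12] : [/\ D <= e, D <= u1 - u0 & D <= u2 - u1].
  by rewrite /D !ge_min !lexx !orbT.
have n1 := normr_ge0 s1; have n2 := normr_ge0 s2.
(* With this denominator [h], [h * |s1|] and [h * |s2|] sum to [D / 2], so the points [a] and [b]
   below stay over the two edges and within [e] of [(u1, c)]. *)
pose h := D / (2 * (1 + `|s1| + `|s2|)).
have h0 : 0 < h by rewrite divr_gt0// mulr_gt0//; lra.
have hE : h + h * `|s1| + h * `|s2| = D / 2 by rewrite /h; field; lra.
have h1 : 0 <= h * `|s1| by rewrite mulr_ge0// ltW.
have h2 : 0 <= h * `|s2| by rewrite mulr_ge0// ltW.
have [hs1 hs1'] : h * s1 <= h * `|s1| /\ - (h * `|s1|) <= h * s1.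
  by rewrite -mulrN !ler_pM2l// ler_norm lerNnormlW.
have [hs2 hs2'] : h * s2 <= h * `|s2| /\ - (h * `|s2|) <= h * s2.
  by rewrite -mulrN !ler_pM2l// ler_norm lerNnormlW.
have aE : g k u0 + s1 * (u1 - h - u0) = c - h * s1.
  by rewrite /s1 /slope -/c; field; lra.
have ain : u0 <= u1 - h <= u1 by lra.
have bin : u1 <= u1 + h <= u2 by lra.
have fa := link_chord u01 l01 km ain; have a0 := chord_gt0 u01 km ain.
have fb := link_chord u12 l12 k'm bin; have b0 := chord_gt0 u12 k'm bin.
rewrite -/s1 aE in fa a0.
rewrite -/s2 gkk' (_ : u1 + h - u1 = h) in fb b0; last by ring.
set a := (u1 - h, c - h * s1) in fa.
set b := (u1 + h, _) in fb.
have hh : 0 <= (2^-1 : R) <= 1 by lra.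
(* If the turn were concave, the midpoint of [a, b] would lie below level [p],
   so that [S a b >= (k + 1) + (k' + 1) - p = q + 1]. *)
have := @S_add a b 2^-1 a0 b0 hh.
have yE : lerp 2^-1 a b = (u1, c - h * (s1 - s2) / 2).
  by rewrite /lerp /a /b /=; congr pair; field.
have y0 : 0 < c - h * (s1 - s2) / 2 by lra.
have hs : 0 < h * (s1 - s2) by rewrite mulr_gt0// subr_gt0.
rewrite yE; set y := (u1, _).
have fy : (f y <= p)%N.
  rewrite leqNgt; apply/negP => py.
  have pm : (p < m)%N by exact: leq_trans py (f_le _).
  have gp : g p u1 <= c - h * (s1 - s2) / 2 by rewrite -gE.
  have cp : c <= g p u1 by rewrite leNgt -pP// ltnn.
  by clear -gp cp hs; lra.
have fv : (f (u1, c) <= q)%N.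
  rewrite leqNgt; apply/negP => qf.
  have qm : (q < m)%N by exact: leq_trans qf (f_le _).
  by move: qf; rewrite gE// -qP// ltnn.
have Sab : (S a b <= f (u1, c))%N.
  have he : h < e by lra.
  have h1e : h * `|s1| < e by lra.
  have h2e : h * `|s2| < e by lra.
  have [E1 E2] : u1 - h - u1 = - h /\ u1 + h - u1 = h by split; ring.
  have [E3 E4] : c - h * s1 - c = - (h * s1) /\ c + s2 * h - c = h * s2.
    by split; ring.
  by apply: eP; rewrite /a /b /= ?E1 ?E2 ?E3 ?E4 ?normrN ?(normrM h) ?(gtr0_norm h0).
have := @S_gel a y a0 y0; have := @S_ger y b y0 b0.
move: (S a b) (S a y) (S y b) (f a) (f b) (f y) (f (u1, c)) fa fb fy fv Sab kpq.
by clear; lia.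
Qed.

Lemma locate (w : nat -> R) n x : (0 < n)%N -> w 0%N <= x <= w n ->
  exists2 i, (i < n)%N & w i <= x <= w i.+1.
Proof.
case: n => // n _; elim: n => [|n IH] /andP[wx xw].
  by exists 0%N => //; rewrite wx.
have [xn|nx] := leP x (w n.+1).
  by have [|i i_n iP] := IH; [rewrite wx | exists i => //; exact: ltnW].
by exists n.+1 => //; rewrite xw ltW.
Qed.

Lemma seq_bounds (E : seq R) : exists a b, a < b /\ forall e, e \in E -> a <= e <= b.
Proof.
elim: E => [|e E [a [b [ab abP]]]]; first by exists 0, 1; split; rewrite ?ltr01.
exists (Num.min a e), (Num.max b e); split.
  by rewrite lt_max gt_min ab.
move=> e'; rewrite inE ge_min le_max => /orP[/eqP ->|/abP/andP[-> ->]]//.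
by rewrite lexx !orbT.
Qed.

Lemma terrain_cover_levels (E : seq (R * R)) :
  (forall p, p \in E -> 0 < p.2 /\ (0 < f p)%N) ->
  exists D : 'I_m -> set (R * R), [/\
    forall s p q l, D s p -> D s q -> 0 <= l <= 1 -> D s (lerp l p q),
    forall s p, D s p -> 0 < p.2 /\ (0 < f p)%N &
    forall p, p \in E -> exists s, D s p].
Proof.
move=> EP; have [a [b [ab abP]]] := seq_bounds [seq p.1 | p <- E].
have [n [w [w0 wn wi wE]]] := chained_all [seq p.1 | p <- E] (ltW ab) link_loc.
have n0 : (0 < n)%N by case: n wn {wi wE} => // wn; move: ab; rewrite -wn w0 ltxx.
have wlt i : (i < n)%N -> w i < w i.+1 by move=> /wi[].
have wl i : (i < n)%N -> link (w i) (w i.+1) by move=> /wi[].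
have /choice[t tP] u := block_reversal (h := fun k => g k u)
  (fun j k => @level_homo j k u).
(* [K s i] is the level followed by the polygonal line [s] between the nodes
   [i] and [i + 1]. *)
pose K := fix K (s i : nat) := if i is i'.+1 then t (w i) (K s i') else s.
have Km s i : (s < m)%N -> (K s i < m)%N.
  by move=> sm; elim: i => //= i IH; have [] := tP (w i.+1) _ IH.
(* As every [t (w i)] is an involution, each level is followed by some line on each edge. *)
have Ksurj i k : (k < m)%N -> exists2 s, (s < m)%N & K s i = k.
  elim: i k => [|i IH] k km; first by exists k.
  have [tm tt _ _] := tP (w i.+1) k km.
  by have [s sm sE] := IH _ tm; exists s => //=; rewrite sE.
pose h s i := g (K s i) (w i).
pose sl s i := slope (K s i) (w i) (w i.+1).
have hS s i : (s < m)%N -> (i < n)%N -> h s i.+1 = h s i + sl s i * (w i.+1 - w i).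
  move=> sm i_n; have [_ _ hE _] := tP (w i.+1) _ (Km s i sm).
  have := wlt i i_n => wwi.
  by rewrite /h /= hE /sl /slope; field; lra.
have slS s i : (s < m)%N -> (i.+1 < n)%N -> sl s i <= sl s i.+1.
  move=> sm i_n; have i_n' := ltnW i_n.
  have [tm _ hE [p [q [pq pP qP]]]] := tP (w i.+1) _ (Km s i sm).
  exact: (turn (wlt _ i_n') (wlt _ i_n) (wl _ i_n') (wl _ i_n) (Km s i sm) tm hE pq pP qP).
have above s i j : (s < m)%N -> (i < n)%N -> (j <= n)%N ->
    h s i + sl s i * (w j - w i) <= h s j.
  by move=> sm; apply: convex_seq_above => // k kn; [exact: hS | exact: slS].
(* The part over [[a, b]] above all edge lines of the polygonal line [s]: an intersection of half
   planes, hence convex. *)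
exists (fun s => [set p | a <= p.1 <= b /\
  forall i, (i < n)%N -> h s i + sl s i * (p.1 - w i) <= p.2]); split.
- move=> s p q l [/andP[ap pb] pP] [/andP[aq qb] qP] /andP[l0 l1]; split => /=.
    have h1 : 0 <= (1 - l) * (p.1 - a) by rewrite mulr_ge0 ?subr_ge0.
    have h2 : 0 <= l * (q.1 - a) by rewrite mulr_ge0 ?subr_ge0.
    have h3 : 0 <= (1 - l) * (b - p.1) by rewrite mulr_ge0 ?subr_ge0.
    have h4 : 0 <= l * (b - q.1) by rewrite mulr_ge0 ?subr_ge0.
    by apply/andP; split; lra.
  by move=> i i_n; apply: lerp_above_line; rewrite ?l0//; [exact: pP | exact: qP].
(* Over edge [i] the point lies above a chord of level [K s i], where the weight already exceeds
   [K s i]. *)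
- move=> s p [pab pP]; have sm := ltn_ord s.
  have [|i i_n wip] := @locate w n p.1 n0; first by rewrite w0 wn.
  have c0 := chord_gt0 (wlt _ i_n) (Km s i sm) wip.
  have fc := link_chord (wlt _ i_n) (wl _ i_n) (Km s i sm) wip.
  have pc := pP i i_n; split; first exact: lt_le_trans pc.
  rewrite [p]surjective_pairing; apply: leq_trans (f_vert _ c0 pc).
  exact: leq_ltn_trans fc.
(* The point lies over a node [w j]. Positive weight puts it above the graph of level 0, hence above
   the line that follows level 0 there. *)
- move=> p pE; have [p0 fp] := EP p pE.
  have m0 : (0 < m)%N by apply: leq_trans fp _; exact: f_le.
  have pE1 : p.1 \in [seq p.1 | p <- E] by apply: map_f.
  have [j jn wj] := wE _ pE1 (abP _ pE1).
  have [s sm sj] := Ksurj j 0%N m0.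
  exists (Ordinal sm); split; first exact: abP.
  move=> i i_n /=; rewrite -wj; apply: le_trans (above _ _ _ sm i_n jn) _.
  rewrite /h sj wj -gE//; by rewrite -surjective_pairing.
Qed.

End Levels.

Lemma terrain_cover (E : seq (R * R)) :
  (forall p, p \in E -> 0 < p.2 /\ (0 < f p)%N) ->
  exists D : 'I_m -> set (R * R), [/\
    forall s p q l, D s p -> D s q -> 0 <= l <= 1 -> D s (lerp l p q),
    forall s p, D s p -> 0 < p.2 /\ (0 < f p)%N &
    forall p, p \in E -> exists s, D s p].
Proof.
have [g gP] := choice (fun ku : nat * R => level_exists ku.1 ku.2).
by apply: (terrain_cover_levels (g := fun k u => g (k, u))) => k u; exact: (gP (k, u)).
Qed.

End Terrain.

(** * Fattened segments *)

Section Segments.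
Variable R : realType.
Implicit Types (a b z w : 'rV[R]_2) (e l : R) (K : set 'rV[R]_2).

Definition lin l a b := (1 - l) *: a + l *: b.

Lemma conv_lin (k : {i01 R}) a b :
  (conv k (a : convex_lmodType 'rV[R]_2) b : 'rV[R]_2) = lin k%:num b a.
Proof. by rewrite /lin addrC. Qed.

Lemma convexP K : convex K <->
  forall a b l, K a -> K b -> 0 <= l <= 1 -> K (lin l a b).
Proof.
split => [cK a b l Ka Kb /andP[l0 l1]|cK a b l].
  have := cK b a (Itv01 l0 l1); rewrite !inE conv_lin.
  exact.
by rewrite !inE conv_lin => Ka Kb; apply: cK => //; rewrite ge0 le1.
Qed.

Lemma convexI K (L : set 'rV[R]_2) : convex K -> convex L -> convex (K `&` L).
Proof.
move=> /convexP cK /convexP cL; apply/convexP => a b l [Ka La] [Kb Lb] l01.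
by split; [exact: cK | exact: cL].
Qed.

Lemma linxx l a : lin l a a = a.
Proof. by rewrite /lin -scalerDl subrK scale1r. Qed.

Lemma lin0 a b : lin 0 a b = a.
Proof. by rewrite /lin subr0 scale1r scale0r addr0. Qed.

Lemma lin1 a b : lin 1 a b = b.
Proof. by rewrite /lin subrr scale1r scale0r add0r. Qed.

Lemma lin_norm l a b w e : 0 <= l <= 1 -> `|w - a| <= e -> `|w - b| <= e ->
  `|w - lin l a b| <= e.
Proof.
move=> /andP[l0 l1] ae be.
rewrite (_ : w - _ = lin l (w - a) (w - b)); last first.
  by apply/rowP => j; rewrite !mxE; ring.
apply: le_trans (ler_normD _ _) _; rewrite !normrZ ger0_norm ?subr_ge0// (ger0_norm l0).
have l1' : 0 <= 1 - l by rewrite subr_ge0.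
by have := ler_wpM2l l1' ae; have := ler_wpM2l l0 be; lra.
Qed.

(** The closed [e]-neighbourhood of the segment; its weight is the weight of the segment under the
    fattened valuation. *)
Definition tseg e a b := [set z | exists2 l, 0 <= l <= 1 & `|z - lin l a b| <= e].

Lemma tseg_xx e a : tseg e a a = [set z | `|z - a| <= e].
Proof.
apply/seteqP; split => z /= => [[l _]|ze]; first by rewrite linxx.
by exists 0; rewrite ?lexx ?ler01 ?linxx.
Qed.

Lemma tseg0 a : tseg 0 a a = [set a].
Proof.
rewrite tseg_xx; apply/seteqP; split => z /=; last by move=> ->; rewrite subrr normr0.
by rewrite normr_le0 subr_eq0 => /eqP.
Qed.

Lemma tseg_lin e l a b : 0 <= l <= 1 -> tseg e (lin l a b) (lin l a b) `<=` tseg e a b.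
Proof. by move=> l01; rewrite tseg_xx => z ze; exists l. Qed.

Lemma tseg_l e a b : tseg e a a `<=` tseg e a b.
Proof. by have := @tseg_lin e 0 a b; rewrite lin0; apply; rewrite lexx ler01. Qed.

Lemma tseg_r e a b : tseg e b b `<=` tseg e a b.
Proof. by have := @tseg_lin e 1 a b; rewrite lin1; apply; rewrite lexx ler01. Qed.

Lemma tseg_convex e a b : convex (tseg e a b).
Proof.
apply/convexP => z w l [s s01 zs] [t t01 wt] /andP[l0 l1].
have l1' : 0 <= 1 - l by rewrite subr_ge0.
exists ((1 - l) * s + l * t).
  case/andP: s01 => s0 s1; case/andP: t01 => t0 t1.
  have h1 := mulr_ge0 l1' s0; have h2 := mulr_ge0 l0 t0.
  have h3 : 0 <= (1 - l) * (1 - s) by rewrite mulr_ge0 ?subr_ge0.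
  have h4 : 0 <= l * (1 - t) by rewrite mulr_ge0 ?subr_ge0.
  by apply/andP; split; lra.
rewrite (_ : _ - _ = (1 - l) *: (z - lin s a b) + l *: (w - lin t a b)); last first.
  by apply/rowP => j; rewrite !mxE; ring.
apply: le_trans (ler_normD _ _) _; rewrite !normrZ ger0_norm// (ger0_norm l0).
by have := ler_wpM2l l1' zs; have := ler_wpM2l l0 wt; lra.
Qed.

(** The distance from [z] to the segment is attained at some parameter in [[0, 1]]. If it exceeded
    [e], the ball around [z] with the excess as radius would miss the set. *)
Lemma tseg_closed e a b : closed (tseg e a b).
Proof.
move=> z zcl; pose d l := `|z - lin l a b|.
have dc : {within `[0, 1], continuous d}.
  apply: continuous_subspaceT => l; apply: cvg_norm; apply: cvgB; first exact: cvg_cst.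
  apply: cvgD; apply: cvgZr_tmp; last exact: cvg_id.
  by apply: cvgB; [exact: cvg_cst | exact: cvg_id].
have [c c01 cmin] := EVT_min ler01 dc.
exists c; first by move: c01; rewrite in_itv.
rewrite leNgt; apply/negP => ec.
have /zcl [w [[l l01 wl] zw]] : nbhs z (ball z (d c - e)).
  by apply: nbhsx_ballx; rewrite subr_gt0.
have lI : l \in `[0, 1] by rewrite in_itv.
have := cmin l lI; apply/negP; rewrite -ltNge /d.
rewrite (_ : z - lin l a b = (z - w) + (w - lin l a b)); last by rewrite addrA subrK.
apply: le_lt_trans (ler_normD _ _) _.
move: zw; rewrite -ball_normE /= => zw; rewrite -/(d c); lra.
Qed.

Lemma tsegU e l a b : 0 <= l <= 1 ->
  tseg e a b = tseg e a (lin l a b) `|` tseg e (lin l a b) b.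
Proof.
move=> /andP[l0 l1]; apply/seteqP; split => w.
  move=> [t /andP[t0 t1] wt]; have [tl|lt] := leP t l.
    left; have [l_eq0|ln0] := eqVneq l 0.
      exists 0; rewrite ?lexx ?ler01// lin0.
      by move: wt; rewrite (_ : t = 0) ?lin0//; apply/eqP; rewrite eq_le t0 -l_eq0 tl.
    have lgt0 : 0 < l by rewrite lt_neqAle eq_sym ln0.
    exists (t / l); first by rewrite divr_ge0//= ler_pdivrMr ?mul1r.
    rewrite (_ : lin _ _ _ = lin t a b)//.
    by apply/rowP => j; rewrite !mxE; field.
  right; have l1' : 0 < 1 - l by lra.
  exists ((t - l) / (1 - l)).
    by rewrite divr_ge0 ?subr_ge0 ?(ltW lt)//= ler_pdivrMr// mul1r lerD2r.
  rewrite (_ : lin _ _ _ = lin t a b)//.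
  by apply/rowP => j; rewrite !mxE; field; lra.
case=> [] [t /andP[t0 t1] wt].
  exists (t * l); first by rewrite mulr_ge0//= mulr_ile1.
  rewrite (_ : lin _ _ _ = lin t a (lin l a b))//.
  by apply/rowP => j; rewrite !mxE; ring.
exists ((1 - t) * l + t).
  have h1 : 0 <= (1 - t) * l by rewrite mulr_ge0// subr_ge0.
  have h2 : 0 <= (1 - t) * (1 - l) by rewrite mulr_ge0// subr_ge0.
  by apply/andP; split; lra.
rewrite (_ : lin _ _ _ = lin t (lin l a b) b)//.
by apply/rowP => j; rewrite !mxE; ring.
Qed.

(** A point near both halves is near a point on each side of the cut; by convexity of balls it is
    near the cut, which lies between them. *)
Lemma tsegI e l a b : 0 <= l <= 1 ->
  tseg e a (lin l a b) `&` tseg e (lin l a b) b = tseg e (lin l a b) (lin l a b).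
Proof.
move=> /andP[l0 l1]; apply/seteqP; split; last first.
  by move=> w ww; split; [exact: tseg_r | exact: tseg_l].
move=> w [[s /andP[s0 s1] ws] [t /andP[t0 t1] wt]]; rewrite tseg_xx /=.
have a0 : 0 <= (1 - s) * l by rewrite mulr_ge0// subr_ge0.
have b0 : 0 <= t * (1 - l) by rewrite mulr_ge0// subr_ge0.
move: a0; rewrite le_eqVlt => /orP[/eqP a0|a0].
  move: ws; rewrite (_ : lin s _ _ = lin l a b)//.
  apply/rowP => j; rewrite !mxE.
  rewrite -[RHS]addr0 -[in RHS](mul0r (a ord0 j - b ord0 j)) a0; ring.
(* [al] and [be] are the parameter distances from the cut to the left and right points; the cut
   divides the segment between these in the ratio [al : be]. For [al = 0] the left point is the cut
   itself. *)
set al := (1 - s) * l in a0; set be := t * (1 - l) in b0.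
have ab0 : 0 < al + be by lra.
rewrite [X in w - X](_ : _ = lin (al / (al + be)) (lin s a (lin l a b)) (lin t (lin l a b) b)).
  apply: lin_norm => //.
  by rewrite divr_ge0 ?(ltW a0) ?(ltW ab0)//= ler_pdivrMr// mul1r; lra.
by apply/rowP => j; rewrite !mxE /al /be; field; rewrite -/al -/be; lra.
Qed.

End Segments.

(** * The projective chart *)

Section Chart.
Variable R : realType.

Definition vec2 (a b : R) : 'rV[R]_2 := \row_j (if j == ord0 then a else b).

Lemma norm_entry (v : 'rV[R]_2) j : `|v ord0 j| <= `|v|.
Proof.
rewrite [leRHS]/Num.norm /= mx_normrE.
by apply: (le_bigmax _ (fun ij : 'I_1 * 'I_2 => `|v ij.1 ij.2|) (ord0, j)).
Qed.

Lemma norm_rV_le (v : 'rV[R]_2) e : 0 <= e -> (forall j, `|v ord0 j| <= e) -> `|v| <= e.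
Proof.
move=> e0 ve; rewrite [leLHS]/Num.norm /= mx_normrE.
by apply/bigmax_leP; split=> // -[i j] _ /=; rewrite ord1.
Qed.

Lemma norm_vec2 a b : `|vec2 a b| <= `|a| + `|b|.
Proof.
apply: norm_rV_le => [|j]; first exact: addr_ge0.
by rewrite mxE; case: ifP => _; rewrite ?lerDl ?lerDr.
Qed.

Variables (x : 'rV[R]_2) (eta : R).

(* The projective map (u, t) |-> x + (eta / t, u / t): it preserves segments of
   {t > 0}, and x corresponds to the point at infinity t = +oo. *)
Definition chart (p : R * R) := x + p.2^-1 *: vec2 eta p.1.

(** The barycentric weights [1 - l] and [l] are multiplied by the heights [p.2] and [q.2], then
    renormalised. *)
Lemma chart_lerp l p q : 0 < p.2 -> 0 < q.2 -> 0 <= l <= 1 ->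
  exists2 k, 0 <= k <= 1 & chart (lerp l p q) = lin k (chart p) (chart q).
Proof.
move=> p0 q0 l01; have r0 : 0 < (lerp l p q).2 by exact: lerp_gt0.
have /andP[l0 l1] := l01; rewrite /= in r0.
exists (l * q.2 / (lerp l p q).2) => /=.
  rewrite divr_ge0 ?mulr_ge0 ?(ltW q0) ?(ltW r0)//= ler_pdivrMr// mul1r lerDr.
  by rewrite mulr_ge0 ?(ltW p0) ?subr_ge0.
apply/rowP => j; rewrite /chart /lin !mxE /=.
by case: ifP => _; field; rewrite !gt_eqF.
Qed.

(** The inverse reparametrisation: weights are divided by the heights, then renormalised. *)
Lemma chart_lin l p q : 0 < p.2 -> 0 < q.2 -> 0 <= l <= 1 ->
  exists2 k, 0 <= k <= 1 & lin l (chart p) (chart q) = chart (lerp k p q).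
Proof.
move=> p0 q0 l01; have d0 := lerp_gt0 l01 q0 p0; have /andP[l0 l1] := l01.
exists (l * p.2 / ((1 - l) * q.2 + l * p.2)) => /=.
  rewrite divr_ge0 ?mulr_ge0 ?(ltW p0) ?(ltW d0)//= ler_pdivrMr// mul1r lerDr.
  by rewrite mulr_ge0 ?(ltW q0) ?subr_ge0.
apply/rowP => j; rewrite /chart /lin !mxE /=.
have h : (1 - l * p.2 / ((1 - l) * q.2 + l * p.2)) * p.2 +
   l * p.2 / ((1 - l) * q.2 + l * p.2) * q.2 = p.2 * q.2 / ((1 - l) * q.2 + l * p.2).
  by field; rewrite gt_eqF.
by rewrite h; case: ifP => _; field; rewrite !gt_eqF.
Qed.

(** The sign of [eta] selects the side of the vertical line through [x]; the preimage has height
    [eta] divided by the horizontal offset. *)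
Lemma chart_surj (y : 'rV[R]_2) : 0 < eta * (y ord0 ord0 - x ord0 ord0) ->
  exists2 p, 0 < p.2 & y = chart p.
Proof.
move=> yx; set d := y ord0 ord0 - x ord0 ord0 in yx.
have dn0 : d != 0 by apply: contraTneq yx => ->; rewrite mulr0 ltxx.
have en0 : eta != 0 by apply: contraTneq yx => ->; rewrite mul0r ltxx.
exists (eta / d * (y ord0 (lift ord0 ord0) - x ord0 (lift ord0 ord0)), eta / d) => /=.
  rewrite (_ : eta / d = eta * d / (d ^+ 2)); last by field.
  by rewrite divr_gt0// exprn_even_gt0.
apply/rowP => j; rewrite /chart !mxE /=; case: (unliftP ord0 j) => [k ->|->].
  by rewrite ord1 /=; field; rewrite dn0.
by rewrite eqxx invf_div divfK// /d addrC subrK.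
Qed.

Lemma chart_cont p d : 0 < p.2 -> 0 < d -> exists2 e, 0 < e &
  forall a : R * R, `|a.1 - p.1| < e -> `|a.2 - p.2| < e ->
    `|chart a - chart p| <= d.
Proof.
case: p => u t /= t0 d0.
have c2 : (a.2^-1 : R) @[a --> (u, t)] --> t^-1.
  by apply: cvgV; [rewrite gt_eqF | exact: cvg_snd].
have c1 : (a.2^-1 * a.1 : R) @[a --> (u, t)] --> t^-1 * u.
  by apply: cvgM; [exact: c2 | exact: cvg_fst].
have c0 : (a.2^-1 * eta : R) @[a --> (u, t)] --> t^-1 * eta.
  by apply: cvgM; [exact: c2 | exact: cvg_cst].
have N : \forall a \near (u, t), `|t^-1 * eta - a.2^-1 * eta| < d /\
    `|t^-1 * u - a.2^-1 * a.1| < d.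
  move/cvgrPdist_lt: c0 => /(_ _ d0) n0; move/cvgrPdist_lt: c1 => /(_ _ d0) n1.
  exact: filterI n0 n1.
have [e /= e0 eP] := (nbhs_ballP _ _).1 N.
exists e => // a a1 a2; have /eP [b1 b2] : ball (u, t) e a.
  by split; rewrite -ball_normE /= distrC.
apply: norm_rV_le; first exact: ltW.
move=> j; rewrite !mxE /= (_ : _ - _ = - (t^-1 * (if j == ord0 then eta else u) -
  a.2^-1 * (if j == ord0 then eta else a.1))); last by ring.
by rewrite normrN; case: ifP => _; exact: ltW.
Qed.

End Chart.

(** * Polyconvex sets with closed components *)

Section Polyconvex.
Variable R : realType.
Implicit Types (A : set 'rV[R]_2).

Lemma closure_convex A : convex A -> convex (closure A).
Proof.
move=> /convexP cA; apply/convexP => a b l ca cb l01 N /nbhs_ballP[e /= e0 eN].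
have [a' [Aa' aa']] := ca _ (nbhsx_ballx a e e0).
have [b' [Ab' bb']] := cb _ (nbhsx_ballx b e e0).
exists (lin l a' b'); split; first exact: cA.
apply: eN; rewrite -ball_normE /=.
move: aa' bb'; rewrite -!ball_normE /= => aa' bb'.
rewrite (_ : _ - _ = (1 - l) *: (a - a') + l *: (b - b')); last first.
  by apply/rowP => j; rewrite !mxE; ring.
apply: le_lt_trans (ler_normD _ _) _; have /andP[l0 l1] := l01.
rewrite !normrZ ger0_norm ?subr_ge0// (ger0_norm l0).
move: aa' bb'; rewrite -subr_gt0 => aa'; rewrite -subr_gt0 => /(lerp_gt0 l01 aa').
lra.
Qed.

Lemma polyconvex_bigcup (T : finType) (C : T -> set 'rV[R]_2) :
  (forall t, convex (C t)) -> (forall t, closed (C t)) ->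
  polyconvex_closed_components (\bigcup_t C t).
Proof.
move=> cC clC; exists #|T|, (fun i => C (enum_val i)); split; last by move=> i.
split=> //; apply/seteqP; split => y [t _ Cy].
  by exists (enum_rank t) => //; rewrite enum_rankK.
by exists (enum_val t).
Qed.

(** The convex pieces produced by the ultrafilter are not known to be closed; since [F] is closed,
    their closures stay inside it. *)
Lemma polyconvex_closure (T : finType) (F : set 'rV[R]_2) (A : T -> set 'rV[R]_2) :
  closed F -> (forall t, convex (A t)) -> (forall t, A t `<=` F) ->
  (forall y, F y -> exists t, A t y) -> polyconvex_closed_components F.
Proof.
move=> clF cA AF FA; rewrite (_ : F = \bigcup_t closure (A t)).
  by apply: polyconvex_bigcup => t; [exact: closure_convex | exact: closed_closure].
apply/seteqP; split => [y /FA[t Aty]|y [t _]].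
  by exists t => //; exact: subset_closure.
by move=> /(closureS (AF t)); rewrite -(closure_id F).1.
Qed.

Lemma polyconvexU (F G : set 'rV[R]_2) :
  polyconvex_closed_components F -> polyconvex_closed_components G ->
  polyconvex_closed_components (F `|` G).
Proof.
move=> [n [C [[cC ->] clC]]] [k [D [[cD ->] clD]]].
rewrite (_ : _ `|` _ = \bigcup_t (match t : 'I_n + 'I_k with
  | inl i => C i | inr j => D j end)).
  by apply: polyconvex_bigcup => -[].
apply/seteqP; split => y.
  by case=> [[i _ Cy]|[j _ Dy]]; [exists (inl i) | exists (inr j)].
by case=> [[i|j] _ Cy]; [left; exists i | right; exists j].
Qed.

Lemma polyconvex0 : polyconvex_closed_components (set0 : set 'rV[R]_2).
Proof.
exists 0%N, (fun=> set0); split; last by case.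
by split; [case | apply/seteqP; split => y // [[]]].
Qed.

End Polyconvex.

(** A point of the line between [a] and [b] lies between 0 and one of them. Hence a subset of a line
    that is star-shaped at a point is convex. *)
Lemma between_multiple (R : realType) (a b l : R) : 0 <= l <= 1 ->
  exists2 k, 0 <= k <= 1 & (1 - l) * a + l * b = k * a \/ (1 - l) * a + l * b = k * b.
Proof.
move=> /andP[l0 l1]; set c := _ + _.
have H (d : R) : 0 <= c <= d \/ d <= c <= 0 -> exists2 k, 0 <= k <= 1 & c = k * d.
  have [->|d0 cd] := eqVneq d 0.
    by move=> h; exists 0; rewrite ?lexx ?ler01// mul0r; case: h => /andP[? ?]; lra.
  exists (c / d); last by rewrite divfK.
  case: cd => /andP[h1 h2].
    have dp : 0 < d by rewrite lt_neqAle eq_sym d0 (le_trans h1).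
    by rewrite divr_ge0 ?(ltW dp)//= ler_pdivrMr// mul1r.
  have dn : d < 0 by rewrite lt_neqAle d0 (le_trans h1).
  by rewrite ler_ndivrMr// mul1r h1 andbT mulr_le0// invr_le0 ltW.
suff [/H[k k01 ck]|/H[k k01 ck]] : (0 <= c <= a \/ a <= c <= 0) \/ (0 <= c <= b \/ b <= c <= 0).
- by exists k => //; left.
- by exists k => //; right.
have l1' : 0 <= 1 - l by lra.
have [ab|ba] := leP a b.
  have h1 : 0 <= l * (b - a) by rewrite mulr_ge0// subr_ge0.
  have h2 : 0 <= (1 - l) * (b - a) by rewrite mulr_ge0// subr_ge0.
  have [ac cb] : a <= c /\ c <= b by rewrite /c; split; lra.
  have [c0|c0] := leP 0 c.
    by right; left; rewrite ?c0.
  by left; right; rewrite ac ltW.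
have h1 : 0 <= l * (a - b) by rewrite mulr_ge0// subr_ge0 ltW.
have h2 : 0 <= (1 - l) * (a - b) by rewrite mulr_ge0// subr_ge0 ltW.
have [bc ca] : b <= c /\ c <= a by rewrite /c; split; lra.
have [c0|c0] := leP 0 c.
  by left; left; rewrite ?c0.
by right; right; rewrite bc ltW.
Qed.

(** * Valuations with a point of full weight *)

Section PlaneValuation.
(** In the application [nu] is [phi] after intersection with a small convex set around [x] of the
    same weight as [x]. For natural values, continuity means that the limit is attained, as in
    [nu_cont]. *)
Variables (R : realType) (nu : set 'rV[R]_2 -> nat) (x : 'rV[R]_2) (rad : R).
Hypothesis rad_ge0 : 0 <= rad.
Hypothesis nuU : forall K L, closed K -> convex K -> closed L -> convex L ->
  convex (K `|` L) -> (nu (K `|` L) + nu (K `&` L) = nu K + nu L)%N.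
Hypothesis nuS : forall K L, closed K -> convex K -> closed L -> convex L ->
  K `<=` L -> (nu K <= nu L)%N.
Hypothesis nu_cont : forall K_ : nat -> set 'rV[R]_2,
  (forall n, closed (K_ n)) -> (forall n, convex (K_ n)) ->
  (forall n, K_ n.+1 `<=` K_ n) -> exists n, nu (K_ n) = nu (\bigcap_n K_ n).
Hypothesis nu_far : forall K, (forall z, K z -> rad < `|z - x|) -> nu K = 0%N.
Hypothesis nu_full : (nu setT <= nu [set x])%N.
Local Notation m := (nu [set x]).
Implicit Types (a b c y z : 'rV[R]_2) (e l : R).

Local Notation S e a b := (nu (tseg e a b)).

Let S_sub e a b e' a' b' : tseg e a b `<=` tseg e' a' b' -> (S e a b <= S e' a' b')%N.
Proof.
by apply: nuS;
  [exact: tseg_closed | exact: tseg_convex | exact: tseg_closed | exact: tseg_convex].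
Qed.

Lemma S_add e a b l : 0 <= l <= 1 ->
  (S e a b + S e (lin l a b) (lin l a b) = S e a (lin l a b) + S e (lin l a b) b)%N.
Proof.
move=> l01; rewrite [in nu (tseg e a b)](tsegU e a b l01) -(tsegI e a b l01).
apply: nuU; [exact: tseg_closed|exact: tseg_convex|exact: tseg_closed|exact: tseg_convex|].
by rewrite -tsegU//; exact: tseg_convex.
Qed.

Lemma S_le e a b : (S e a b <= m)%N.
Proof.
apply: leq_trans nu_full; apply: nuS => //; [exact: tseg_closed|exact: tseg_convex].
Qed.

Lemma S_full e c : `|c - x| <= e -> (m <= S e c c)%N.
Proof.
move=> cx; rewrite -[[set x]]tseg0; apply: S_sub.
by rewrite tseg0 tseg_xx => _ -> /=; rewrite distrC.
Qed.

(** The part from [c] to the cut already has the maximal weight [m], so additivity leaves at the cut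
    at least the weight of the rest, which contains the ball around [y]. *)
Lemma S_star e c y l : (m <= S e c c)%N -> 0 <= l <= 1 ->
  (S e y y <= S e (lin l c y) (lin l c y))%N.
Proof.
move=> mc l01; have := S_add e c y l01.
have := S_le e c y; have := S_sub (@tseg_l _ e c (lin l c y)).
have := S_sub (@tseg_r _ e (lin l c y) y); move: mc.
lia.
Qed.

Let inv_lt (d : R) : 0 < d -> exists n : nat, n.+1%:R^-1 < d.
Proof.
move=> d0; exists (Num.truncn d^-1).
rewrite invf_plt ?posrE// ?ltr0n//; exact: truncnS_gt.
Qed.

Lemma ball_cont e y : exists2 d, 0 < d & nu (tseg (e + d) y y) = S e y y.
Proof.
have [n|n|n|n nE] := nu_cont (K_ := fun n => tseg (e + n.+1%:R^-1) y y).
- exact: tseg_closed.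
- exact: tseg_convex.
- rewrite !tseg_xx => z /= /le_trans; apply; rewrite lerD2l lef_pV2 ?posrE ?ltr0n//.
  by rewrite ler_nat.
exists n.+1%:R^-1; first by rewrite invr_gt0 ltr0n.
rewrite nE; congr nu; apply/seteqP; split => z; rewrite tseg_xx /=.
  move=> zP; rewrite leNgt; apply/negP; rewrite -subr_gt0 => /inv_lt[k hk].
  by have := zP k I; rewrite tseg_xx /= => hz; move: hk; rewrite ltNge lerBlDl hz.
move=> ze k _; rewrite tseg_xx /=; apply: le_trans ze _.
by rewrite lerDl invr_ge0 ler0n.
Qed.

(** Such a fattened segment lies in a slightly larger ball around [y], which by [ball_cont] weighs
    no more. *)
Lemma S_loc e y : exists2 d, 0 < d & forall a b, `|a - y| <= d -> `|b - y| <= d ->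
  (S e a b <= S e y y)%N.
Proof.
have [d d0 dE] := ball_cont e y; exists d => // a b ay yb.
rewrite -dE; apply: S_sub => z [l l01 zl]; rewrite tseg_xx /=.
rewrite (_ : z - y = (z - lin l a b) - (y - lin l a b)); last first.
  by rewrite opprB addrA subrK.
by apply: le_trans (ler_normB _ _) _; apply: lerD => //; apply: lin_norm => //; rewrite distrC.
Qed.

(** Read in the chart, the weights of fattened segments satisfy the hypotheses of [terrain_cover]
    with Lipschitz constant [e^-1]. *)
Lemma half_plane_cover e eta (E : seq 'rV[R]_2) : 0 < e -> eta != 0 ->
  (forall y, y \in E -> (0 < S e y y)%N /\ 0 < eta * (y ord0 ord0 - x ord0 ord0)) ->
  exists D : 'I_m -> set 'rV[R]_2, [/\ forall s, convex (D s),
    forall s y, D s y -> (0 < S e y y)%N & forall y, y \in E -> exists s, D s y].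
Proof.
move=> e0 eta0 EP; pose P := chart x eta.
pose S' (p q : R * R) := S e (P p) (P q).
have L0 : 0 <= e^-1 by rewrite invr_ge0 ltW.
have H1 (p q : R * R) (l : R) : 0 < p.2 -> 0 < q.2 -> 0 <= l <= 1 ->
    (S' p q + S' (lerp l p q) (lerp l p q) = S' p (lerp l p q) + S' (lerp l p q) q)%N.
  move=> p0 q0 l01; rewrite /S' /P; have [k k01 ->] := chart_lerp x eta p0 q0 l01.
  exact: S_add.
have H2 (p q : R * R) : 0 < p.2 -> 0 < q.2 -> (S' p p <= S' p q)%N.
  by move=> _ _; apply: S_sub; exact: tseg_l.
have H3 (p q : R * R) : 0 < p.2 -> 0 < q.2 -> (S' q q <= S' p q)%N.
  by move=> _ _; apply: S_sub; exact: tseg_r.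
have H4 (p : R * R) : 0 < p.2 -> exists2 e : R, 0 < e & forall a b : R * R,
    `|a.1 - p.1| < e -> `|a.2 - p.2| < e ->
    `|b.1 - p.1| < e -> `|b.2 - p.2| < e -> (S' a b <= S' p p)%N.
  move=> p0; have [d d0 dP] := S_loc e (P p).
  have [e' e'0 e'P] := chart_cont x eta p0 d0.
  exists e'; first by [].
  move=> a b a1 a2 b1 b2.
  exact: (dP (P a) (P b) (e'P a a1 a2) (e'P b b1 b2)).
have H5 (p : R * R) : 0 < p.2 -> (S' p p <= m)%N by move=> _; exact: S_le.
have H6 (u t v t' : R) : 0 < t -> e^-1 * `|v - u| <= t' - t ->
    (S' (u, t) (u, t) <= S' (v, t') (v, t'))%N.
  (* On a vertical line [t' = t] is possible and the centre [c] used below would be undefined; [x]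
     itself serves as centre. *)
  move=> t0 vt; have [vu|vu] := eqVneq v u.
    have tt' : 0 <= t' - t by apply: le_trans vt; rewrite mulr_ge0.
    have t'0 : 0 < t' by lra.
    rewrite vu /S' (_ : P (u, t') = lin (t / t') x (P (u, t))).
      apply: S_star; first by apply: S_full; rewrite subrr normr0 ltW.
      by rewrite divr_ge0 ?(ltW t0) ?(ltW t'0)//= ler_pdivrMr// mul1r -subr_ge0.
    apply/rowP => j; rewrite /P /chart /lin !mxE /=.
    by case: ifP => _; field; rewrite ?(gt_eqF t0) ?(gt_eqF t'0).
  have vu0 : 0 < e^-1 * `|v - u| by rewrite mulr_gt0 ?invr_gt0// normr_gt0 subr_eq0.
  have tt' : 0 < t' - t by exact: lt_le_trans vt.
  have t'0 : 0 < t' by lra.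
  (* The point of the e-ball which the chart sends to the point at infinity of
     the lines of slope (t' - t) / (v - u). *)
  pose c := x + vec2 0 ((v - u) / (t' - t)).
  rewrite /S' (_ : P (v, t') = lin (t / t') c (P (u, t))).
    apply: S_star.
      apply: S_full; rewrite /c addrAC subrr add0r.
      apply: le_trans (norm_vec2 _ _) _; rewrite normr0 add0r normrM normfV.
      by rewrite (gtr0_norm tt') ler_pdivrMr// -ler_pdivrMl.
    by rewrite divr_ge0 ?(ltW t0) ?(ltW t'0)//= ler_pdivrMr// mul1r -subr_ge0 ltW.
  apply/rowP => j; rewrite /P /c /chart /lin !mxE /=.
  by case: ifP => _; field; rewrite ?(gt_eqF t0) ?(gt_eqF t'0) ?(gt_eqF tt').
(* The height [(|eta| + |u|) / e] brings the chart point within [e] of [x]. *)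
have H7 (u : R) : exists2 t : R, 0 < t & (m <= S' (u, t) (u, t))%N.
  have h0 : 0 < `|eta| + `|u| by rewrite ltr_wpDr// normr_gt0.
  exists ((`|eta| + `|u|) / e); first by rewrite divr_gt0.
  apply: S_full; rewrite /P /chart /= addrAC subrr add0r normrZ.
  rewrite invf_div gtr0_norm ?divr_gt0// -ler_pdivlMl ?divr_gt0// invf_div.
  by rewrite divfK ?gt_eqF// norm_vec2.
(* Up to height [|eta| / (rad + e + 1)] the horizontal offset from [x] is at least [rad + e + 1], so
   the whole [e]-ball lies farther than [rad] from [x]. *)
have H8 (u : R) : exists2 t0 : R, 0 < t0 &
    forall t : R, 0 < t -> t <= t0 -> S' (u, t) (u, t) = 0%N.
  have re0 : 0 < rad + e + 1 by rewrite ltr_wpDl ?addr_ge0 ?(ltW e0).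
  exists (`|eta| / (rad + e + 1)); first by rewrite divr_gt0// normr_gt0.
  move=> t t0; rewrite ler_pdivlMr// -ler_pdivlMl// => tle; apply: nu_far => z.
  rewrite tseg_xx /= => zP.
  have Px : rad + e + 1 <= `|P (u, t) - x|.
    rewrite (_ : P (u, t) - x = t^-1 *: vec2 eta u); last first.
      by rewrite /P /chart addrAC subrr add0r.
    apply: le_trans (norm_entry _ ord0); rewrite !mxE eqxx normrM normfV.
    by rewrite (gtr0_norm t0).
  have : `|P (u, t) - x| <= `|z - P (u, t)| + `|z - x|.
    by rewrite (distrC z); apply: ler_distD.
  move: zP Px; move: `|P (u, t) - x| `|z - P (u, t)| `|z - x| => A B C.
  lra.
have /choice[pr prP] (y : 'rV[R]_2) : exists p : R * R, y \in E -> 0 < p.2 /\ y = P p.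
  have [yE|] := boolP (y \in E); last by exists (0, 0).
  by have [_ /chart_surj[p p0 yp]] := EP y yE; exists p.
have [|D [Dc Df DE]] := terrain_cover L0 H1 H2 H3 H4 H5 H6 H7 H8 (E := map pr E).
  move=> p /mapP[y yE ->]; have [p0 yP] := prP y yE; split=> //.
  by rewrite /S' -yP; have [] := EP y yE.
exists (fun s => P @` D s); split.
- move=> s; apply/convexP => _ _ l [p Dp <-] [q Dq <-] l01.
  have [p0 _] := Df s p Dp; have [q0 _] := Df s q Dq.
  have [k k01 ->] := chart_lin x eta p0 q0 l01.
  by exists (lerp k p q) => //; exact: Dc.
- by move=> s _ [p Dp <-]; have [] := Df s p Dp.
- move=> y yE; have [s Ds] := DE _ (map_f pr yE); exists s, (pr y) => //.
  by have [_] := prP y yE.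
Qed.

Local Notation F := [set y | (0 < nu [set y])%N].

(** Covers are indexed by a finite list of points and a scale [ep n]; a point is put in [A s] when
    it belongs to the set [s] of the cover for almost all indices along an ultrafilter. *)
Lemma half_plane_convex eta : eta != 0 -> exists A : 'I_m -> set 'rV[R]_2,
  [/\ forall s, convex (A s), forall s, A s `<=` F &
  forall y, F y -> 0 < eta * (y ord0 ord0 - x ord0 ord0) -> exists s, A s y].
Proof.
move=> eta0; pose ep n : R := n.+1%:R^-1.
have ep0 n : 0 < ep n by rewrite invr_gt0 ltr0n.
pose H := [set y : 'rV[R]_2 | F y /\ 0 < eta * (y ord0 ord0 - x ord0 ord0)].
have /choice[D DP] (i : seq 'rV[R]_2 * nat) : exists D : 'I_m -> set 'rV[R]_2,
    [/\ forall s, convex (D s), forall s y, D s y -> (0 < S (ep i.2) y y)%N &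
    forall y, y \in i.1 -> H y -> exists s, D s y].
  have [|D [Dc Df DE]] := @half_plane_cover (ep i.2) eta [seq y <- i.1 | `[< H y >]] (ep0 _) eta0.
    move=> y; rewrite mem_filter => /andP[/asboolP[Fy yx] _]; split => //.
    apply: leq_trans Fy _; rewrite -tseg0; apply: S_sub.
    by rewrite tseg0 tseg_xx => _ -> /=; rewrite subrr normr0 ltW.
  exists D; split => // y yi Hy; apply: DE; rewrite mem_filter yi andbT.
  exact/asboolP.
(* The tails [B i], with larger lists and finer scales, generate the filter to be refined. *)
pose B (i : seq 'rV[R]_2 * nat) := [set j : seq 'rV[R]_2 * nat |
  {subset i.1 <= j.1} /\ (i.2 <= j.2)%N].
have PF : ProperFilter (filter_from setT B).
  apply: filter_from_proper; last by move=> i _; exists i; split.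
  apply: filter_from_filter; first by exists ([::], 0%N).
  move=> i j _ _; exists (i.1 ++ j.1, maxn i.2 j.2) => // k [/= k1 k2]; split; split.
  - by move=> y yi; apply: k1; rewrite mem_cat yi.
  - by rewrite (leq_trans (leq_maxl _ _) k2).
  - by move=> y yi; apply: k1; rewrite mem_cat yi orbT.
  - by rewrite (leq_trans (leq_maxr _ _) k2).
have [U [UU FU]] := ultraFilterLemma PF.
have UB i : U (B i) by apply: FU; exists i.
exists (fun s => [set y | U [set i | D i s y]]); split.
- move=> s; apply/convexP => a b l Ua Ub l01 /=.
  apply: filterS (filterI Ua Ub) => i [/= Da Db].
  by have [/(_ s)/convexP Dc _ _] := DP i; exact: Dc.
(* At some scale [ep n] the ball around [y] weighs as much as [y], and an index of finer scale shows
   that this weight is positive. *)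
- move=> s y /= Uy.
  have [n|n|n|n nE] := nu_cont (K_ := fun n => tseg (ep n) y y).
  + exact: tseg_closed.
  + exact: tseg_convex.
  + rewrite !tseg_xx => z /= /le_trans; apply; rewrite lef_pV2 ?posrE ?ltr0n//.
    by rewrite ler_nat.
  have -> : [set y] = \bigcap_n tseg (ep n) y y.
    apply/seteqP; split => [_ -> k _|z zP].
      by rewrite tseg_xx /= subrr normr0 ltW.
    apply/eqP; rewrite -subr_eq0 -normr_eq0; apply/negP => /negP.
    rewrite -normr_gt0 normr_id => /inv_lt[k hk].
    by have := zP k I; rewrite tseg_xx /= leNgt hk.
  rewrite -nE.
  have [j [/= Dj [_ nj]]] := filter_ex (filterI Uy (UB ([::], n))).
  have [_ /(_ s y Dj) + _] := DP j; move/leq_trans; apply; apply: S_sub.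
  rewrite !tseg_xx => z /= /le_trans; apply; rewrite lef_pV2 ?posrE ?ltr0n//.
  by rewrite ler_nat.
(* Otherwise the ultrafilter would contain the complements for all of the finitely many [s], hence
   their intersection, although every index whose list contains [y] covers [y]. *)
- move=> y Fy yx; apply: contrapT => nex.
  have Uc s : U (~` [set i | D i s y]).
    have [Us|//] := in_ultra_setVsetC [set i | D i s y] UU.
    by exfalso; apply: nex; exists s.
  have Ua : U [set i | forall s, (~` [set i | D i s y]) i] by exact: filter_forall.
  have [j [/= Dj [yj _]]] := filter_ex (filterI Ua (UB ([:: y], 0%N))).
  have [_ _ /(_ y)] := DP j; case; first by apply: yj; rewrite inE.
    by split.
  by move=> s; exact: Dj.
Qed.

(** The two charts miss the vertical line through [x]. There the support is star-shaped at [x] by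
    [S_star] at scale 0, and dimension one suffices. *)
Lemma axis_convex : convex (F `&` [set y | y ord0 ord0 = x ord0 ord0]).
Proof.
apply/convexP => y z l [/= Fy y0] [/= Fz z0] l01; split; last first.
  by rewrite /lin !mxE y0 z0 -mulrDl subrK mul1r.
pose o : 'I_2 := lift ord0 ord0.
have star w k : 0 <= k <= 1 -> F w -> F (lin k x w).
  move=> k01 Fw /=; apply: leq_trans Fw _.
  rewrite -(tseg0 w) -(tseg0 (lin k x w)).
  by apply: S_star => //; rewrite tseg0.
have [k k01 [ck|ck]] := between_multiple (y ord0 o - x ord0 o) (z ord0 o - x ord0 o) l01.
  rewrite (_ : lin l y z = lin k x y); first exact: star.
  apply/rowP => j; rewrite !mxE; case: (unliftP ord0 j) => [i ->|->].
    rewrite ord1 -/o; move: ck; lra.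
  by rewrite y0 z0; ring.
rewrite (_ : lin l y z = lin k x z); first exact: star.
apply/rowP => j; rewrite !mxE; case: (unliftP ord0 j) => [i ->|->].
  rewrite ord1 -/o; move: ck; lra.
by rewrite y0 z0; ring.
Qed.

(** Some ball around a limit point [y] weighs as much as [y] and contains a point of the support. *)
Lemma support_closed : closed F.
Proof.
move=> y cy /=; have [d d0 dE] := ball_cont 0 y.
have [z [/= Fz yz]] := cy _ (nbhsx_ballx y d d0).
rewrite -(tseg0 y) -dE; apply: leq_trans Fz _; rewrite -(tseg0 z) add0r.
apply: nuS; [exact: tseg_closed|exact: tseg_convex|exact: tseg_closed|exact: tseg_convex|].
rewrite tseg0 tseg_xx => _ -> /=; move: yz; rewrite -ball_normE /= distrC.
exact: ltW.
Qed.

Lemma plane_support_polyconvex : polyconvex_closed_components F.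
Proof.
have [A [cA AF FA]] := half_plane_convex (oner_neq0 R).
have n1 : (- 1 : R) != 0 by rewrite oppr_eq0 oner_neq0.
have [B [cB BF FB]] := half_plane_convex n1.
apply: (polyconvex_closure (T := (option ('I_(nu [set x]) + 'I_(nu [set x])))%type)
  (A := fun t => match t with
    | None => F `&` [set y | y ord0 ord0 = x ord0 ord0]
    | Some (inl s) => A s | Some (inr s) => B s end)).
- exact: support_closed.
- by case=> [[s|s]|]; [exact: cA | exact: cB | exact: axis_convex].
- by case=> [[s|s]|]; [exact: AF | exact: BF | move=> y []].
- move=> y Fy; have [yx|yx|yx] := ltgtP (y ord0 ord0) (x ord0 ord0).
  + by have [|s] := FB y Fy; [rewrite mulN1r opprB subr_gt0 | exists (Some (inr s))].
  + by have [|s] := FA y Fy; [rewrite mul1r subr_gt0 | exists (Some (inl s))].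
  + by exists None.
Qed.

End PlaneValuation.

(** * Localisation of the valuation and the compactness argument *)

Section Main.
Variables (R : realType) (W : set 'rV[R]_2) (phi : set 'rV[R]_2 -> R).
Hypothesis hW : compact_convex W.
Hypothesis hval : valuation_on W phi.
Hypothesis hint : integer_valued_on W phi.
Hypothesis hmono : monotone_on W phi.
Hypothesis hcont : sigma_continuous_on W phi.

Let W_closed : closed W.
Proof. by apply: compact_closed; [exact: norm_hausdorff | have [] := hW]. Qed.

Lemma phi_nat K : closed_convex_in W K -> phi K \is a Num.nat.
Proof.
move=> hK; rewrite natrEint hint//=; have [<- _] := hval.
apply: hmono => //; split => //; exact: closed0.
Qed.

(** Natural numbers at distance less than 1 are equal, so the limit is attained. *)
Lemma phi_stable (K_ : nat -> set 'rV[R]_2) :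
  (forall n, closed_convex_in W (K_ n)) -> (forall n, K_ n.+1 `<=` K_ n) ->
  exists n, phi (K_ n) = phi (\bigcap_n K_ n).
Proof.
move=> hK Kdec.
have hI : closed_convex_in W (\bigcap_n K_ n).
  split; first by apply: closed_bigI => n _; have [] := hK n.
    apply/convexP => a b l Ka Kb l01 n _; have [_ /convexP cK _] := hK n.
    by apply: cK => //; [exact: Ka | exact: Kb].
  by move=> z /(_ 0%N I); have [_ _] := hK 0%N; apply.
have := hcont hK Kdec erefl => /cvgrPdist_lt /(_ _ ltr01) [N _ /(_ N (leqnn N))] /= h.
exists N; move: h; rewrite -(truncnK (phi_nat (hK N))) -(truncnK (phi_nat hI)).
move: (Num.truncn _) (Num.truncn _) => i j.
have [ij|ij|->//] := ltngtP i j.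
  rewrite -natrB ?(ltnW ij)// normr_nat -[X in _ < X]/(1%:R) ltr_nat; lia.
rewrite distrC -natrB ?(ltnW ij)// normr_nat -[X in _ < X]/(1%:R) ltr_nat; lia.
Qed.

Lemma local_polyconvex x : W x -> exists2 r, 0 < r &
  polyconvex_closed_components (support_on W phi `&` tseg r x x).
Proof.
move=> Wx; have [_ cW] := hW.
have hG r : closed_convex_in W (W `&` tseg r x x).
  split; last exact: subIsetl.
    by apply: closedI; [exact: W_closed | exact: tseg_closed].
  by apply: convexI => //; exact: tseg_convex.
have [||n nE] := @phi_stable (fun n => W `&` tseg n.+1%:R^-1 x x).
- by move=> n; exact: hG.
- move=> n z; rewrite !tseg_xx => -[Wz /= h]; split => //.
  by apply: le_trans h _; rewrite lef_pV2 ?posrE ?ltr0n// ler_nat.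
(* The radius at which the weight of the ball in [W] has dropped to that of [x]. *)
pose r : R := n.+1%:R^-1; have r0 : 0 < r by rewrite invr_gt0 ltr0n.
exists r => //; pose G := W `&` tseg r x x.
have bigE : \bigcap_k (W `&` tseg k.+1%:R^-1 x x) = [set x].
  apply/seteqP; split => [z zP|_ -> k _]; last first.
    by split => //; rewrite tseg_xx /= subrr normr0 invr_ge0 ler0n.
  apply/eqP; rewrite -subr_eq0 -normr_eq0; apply/negP => /negP.
  rewrite -normr_gt0 normr_id => z0.
  have [_] := zP (Num.truncn `|z - x|^-1) I; rewrite tseg_xx /= leNgt.
  by rewrite invf_plt ?posrE// ?ltr0n// truncnS_gt.
rewrite bigE -/r -/G in nE.
have GK K : closed K -> convex K -> closed_convex_in W (G `&` K).
  move=> clK cK; have [clG cG GW] := hG r; split.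
  - exact: closedI.
  - exact: convexI.
  - by apply: subset_trans GW; exact: subIsetl.
(* Intersecting with [G] extends the valuation to all closed convex sets of the plane, with the
   whole weight concentrated at [x]. *)
pose nu K := Num.truncn (phi (G `&` K)).
have nuE K : closed K -> convex K -> (nu K)%:R = phi (G `&` K).
  by move=> clK cK; apply: truncnK; apply: phi_nat; exact: GK.
have phi0 : phi set0 = 0 by have [] := hval.
have Gx : G `&` [set x] = [set x].
  apply/seteqP; split => [z []//|_ ->]; split => //; split => //.
  by rewrite tseg_xx /= subrr normr0 ltW.
rewrite (_ : _ `&` _ = [set y | (0 < nu [set y])%N]).
  apply: (@plane_support_polyconvex _ nu x r (ltW r0)).
  - move=> K L clK cK clL cL cKL; apply/eqP; rewrite -(eqr_nat R) !natrD !nuE//.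
    + have [_ /(_ _ _ (GK K clK cK) (GK L clL cL))] := hval.
      rewrite -setIUr -setIIr => ->//; apply: convexI => //.
      by have [] := hG r.
    + exact: closedI.
    + exact: convexI.
    + exact: closedU.
  - move=> K L clK cK clL cL KL; rewrite -(ler_nat R) !nuE//.
    by apply: hmono; [exact: GK | exact: GK | exact: setIS].
  - move=> K_ clK cK Kdec.
    have [||k kE] := @phi_stable (fun k => G `&` K_ k).
    + by move=> k; exact: GK.
    + by move=> k; exact: setIS.
    + exists k; rewrite /nu kE; congr (Num.truncn (phi _)).
      apply/seteqP; split => z zP; last first.
        by move=> i _; have [Gz Kz] := zP; split => //; exact: Kz.
      by split => [|i _]; [have [] := zP 0%N I | have [] := zP i I].
  - move=> K Kfar; rewrite /nu (_ : _ `&` _ = set0) ?phi0 ?truncn0//.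
    apply/seteqP; split => // z [[_ +] /Kfar]; rewrite tseg_xx /= => h.
    by rewrite ltNge h.
  - by rewrite /nu setIT Gx nE.
apply/seteqP; split => y /=.
  move=> [[Wy y1] yr]; rewrite /nu (_ : _ `&` _ = [set y]) ?truncn_gt0//.
  by apply/seteqP; split => [z []//|_ ->].
have [Gy|nGy] := pselect (G y).
  rewrite /nu (_ : _ `&` _ = [set y]) ?truncn_gt0//.
    by move=> h; have [] := Gy.
  by apply/seteqP; split => [z []//|_ ->].
rewrite /nu (_ : _ `&` _ = set0) ?phi0 ?truncn0//.
by apply/seteqP; split => // z [Gz /= zy]; rewrite zy in Gz.
Qed.

(** Finitely many of the local balls cover [W], and finite unions of polyconvex pieces are
    polyconvex. *)
Lemma support_polyconvex : polyconvex_closed_components (support_on W phi).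
Proof.
have [Wc _] := hW.
have /choice[r rP] (x : 'rV[R]_2) : exists r, W x -> 0 < r /\
    polyconvex_closed_components (support_on W phi `&` tseg r x x).
  have [Wx|] := pselect (W x); last by exists 0.
  by have [r r0 rp] := local_polyconvex Wx; exists r.
move: Wc; rewrite compact_cover => /(_ _ W (fun x => ball x (r x))) [].
- by move=> x Wx; apply: ball_open; have [] := rP x Wx.
- by move=> x Wx; exists x => //; apply: ballxx; have [] := rP x Wx.
move=> D DW WD.
have pc (s : seq 'rV[R]_2) : {in s, forall x, W x} ->
    polyconvex_closed_components
      [set y | exists2 x, x \in s & (support_on W phi `&` tseg (r x) x x) y].
  elim: s => [_|x s IH sW].
    rewrite (_ : mkset _ = set0); first exact: polyconvex0.
    by apply/seteqP; split => // y [x].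
  rewrite (_ : mkset _ = (support_on W phi `&` tseg (r x) x x) `|`
    [set y | exists2 x, x \in s & (support_on W phi `&` tseg (r x) x x) y]).
    apply: polyconvexU; last by apply: IH => z zs; apply: sW; rewrite inE zs orbT.
    by have [] := rP x (sW x (mem_head _ _)).
  apply/seteqP; split => y.
    move=> [z]; rewrite inE => /orP[/eqP ->|zs] zy; [by left | by right; exists z].
  move=> [xy|[z zs zy]]; first by exists x; rewrite ?mem_head.
  by exists z => //; rewrite inE zs orbT.
rewrite (_ : support_on W phi =
  [set y | exists2 x, x \in finmap.enum_fset D & (support_on W phi `&` tseg (r x) x x) y]).
  by apply: pc => x xD; have := DW x xD; rewrite inE.
apply/seteqP; split => y; last by move=> [x _ []].
move=> Fy; have [Wy _] := Fy; have [x /= xD xy] := WD y Wy.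
exists x => //; split => //; rewrite tseg_xx /=; move: xy.
by rewrite -ball_normE /= distrC => /ltW.
Qed.

End Main.

Theorem lemma3p7 (R : realType) (W : set 'rV[R]_2) (phi : set 'rV[R]_2 -> R)
  (hW : compact_convex W)
  (hval : valuation_on W phi)
  (hint : integer_valued_on W phi)
  (hmono : monotone_on W phi)
  (hcont : sigma_continuous_on W phi) :
  polyconvex_closed_components (support_on W phi).
Proof. exact: support_polyconvex. Qed.
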